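(* Let $\mathcal{G}$ be a strict 2-group (presented by a crossed module $(G,H,\rhd,\partial)$) and let $\mathbf{C}$ be a small category. A strict 2-functor $\Phi:\mathcal{G}\to \mathrm{End}(\mathbf{C})$ is equivalent to a strict action functor $\hat\Phi:\mathcal{G}\times\mathbf{C}\to\mathbf{C}$.
   Context: A crossed module $(G,H,\rhd,\partial)$ consists of groups $G,H$, an action $\rhd$ of $G$ on $H$ by automorphisms, and a homomorphism $\partial:H\to G$ with $\partial(g\rhd\eta)=g\,\partial(\eta)g^{-1}$ and $\partial(\eta)\rhd\zeta=\eta\zeta\eta^{-1}$. The 2-group $\mathcal{G}$ presented by it is the strict 2-category with one object $\star$, 1-morphisms the elements of $G$ (composition = multiplication in $G$), and 2-morphisms $(\gamma,\chi)\in G\times H$, $(\gamma,\chi):\gamma\Rightarrow\partial(\chi)\gamma$. Vertical composition: $(\partial(\chi)\gamma,\chi')\cdot(\gamma,\chi)=(\gamma,\chi'\chi)$; identity on $\gamma$ is $(\gamma,1_H)$; horizontal composition: $(\gamma_1,\chi_1)\circ(\gamma_3,\chi_2)=(\gamma_1\gamma_3,\chi_1(\gamma_1\rhd\chi_2))$. Equivalently, $\mathcal{G}$ is regarded as a categorical group (a strict monoidal category with strict inverses): objects $G$, morphisms $(\gamma,\chi):\gamma\to\partial(\chi)\gamma$, composition the vertical composition above, and monoidal product $\otimes:\mathcal{G}\times\mathcal{G}\to\mathcal{G}$ given by multiplication in $G$ on objects and by the horizontal composition on morphisms. In the expression $\mathcal{G}\times\mathbf{C}$, $\mathcal{G}$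 denotes this category. $\mathrm{End}(\mathbf{C})$ is the full sub-2-category of $\mathbf{Cat}$ (small categories, functors, natural transformations) on the single object $\mathbf{C}$. A strict 2-functor $\Phi:\mathcal{G}\to\mathrm{End}(\mathbf{C})$ assigns to each $\gamma\in G$ an endofunctor $\Phi_\gamma$ of $\mathbf{C}$ and to each $(\gamma,\chi)$ a natural transformation $\Phi_{(\gamma,\chi)}:\Phi_\gamma\Rightarrow\Phi_{\partial(\chi)\gamma}$ with components $\Phi_{(\gamma,\chi)}(x)$, strictly preserving all (horizontal and vertical) compositions and identities. A strict action functor (strict action of the categorical group $\mathcal{G}$ on $\mathbf{C}$) is a functor $\hat\Phi:\mathcal{G}\times\mathbf{C}\to\mathbf{C}$ such that $\hat\Phi\circ(\otimes\times\mathrm{Id}_{\mathbf{C}})=\hat\Phi\circ(\mathrm{Id}_{\mathcal{G}}\times\hat\Phi)$ as functors $\mathcal{G}\times\mathcal{G}\times\mathbf{C}\to\mathbf{C}$, and which satisfies the unit condition $\hat\Phi(1,x)=x$ for every object $x$ of $\mathbf{C}$, where $1$ is the identity element of $G$.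
   Formalization: The unit condition of a strict action functor is required on morphisms as well as on objects, i.e. Φ̂(1,-) = Id_C; with the condition on objects alone the claim fails (trivial 2-group, C = Z/2 with its trivial endomorphism). *)

(* Defs.v *)
From mathcomp Require Import all_boot.
From mathcomp Require Import boolp.

Set Implicit Arguments.
Unset Strict Implicit.
Unset Printing Implicit Defensive.

Reserved Notation "g \c f" (at level 50, left associativity).
Declare Scope cat_scope.
Delimit Scope cat_scope with cat.
Local Open Scope cat_scope.

#[local] Obligation Tactic := idtac.

(* Equality of morphisms is Leibniz equality; smallness is relative to the
   universe of [Type]. *)
Record category := Category {
  ob :> Type;
  hom : ob -> ob -> Type;
  idm : forall x, hom x x;
  compm : forall x y z, hom y z -> hom x y -> hom x z;
  compmA : forall x y z t (h : hom z t) (g : hom y z) (f : hom x y),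
    compm h (compm g f) = compm (compm h g) f;
  comp1m : forall x y (f : hom x y), compm (idm y) f = f;
  compm1 : forall x y (f : hom x y), compm f (idm x) = f
}.
Arguments hom {c} x y : rename.
Arguments idm {c} x : rename.
Arguments compm {c x y z} g f : rename.
Notation "g \c f" := (compm g f) : cat_scope.

(* A morphism packed with its domain and codomain.  [Arrow f = Arrow g] is the
   set-theoretic equality of morphisms whose (co)domains are only provably
   equal. *)
Record arrow (C : category) := Arrow {
  adom : C; acod : C; amor : hom adom acod
}.
Arguments Arrow {C adom acod} amor.

Record functor (C D : category) := Functor {
  fob :> C -> D;
  fmor : forall x y, hom x y -> hom (fob x) (fob y);
  fmor1 : forall x, fmor (idm x) = idm (fob x);
  fmorM : forall x y z (g : hom y z) (f : hom x y),
    fmor (g \c f) = fmor g \c fmor f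
}.
Arguments fmor {C D} F {x y} f : rename.

Record nat_trans (C D : category) (F G : functor C D) := NatTrans {
  ncomp :> forall x, hom (F x) (G x);
  nnat : forall x y (f : hom x y), ncomp y \c fmor F f = fmor G f \c ncomp x
}.

Lemma Arrow_inj (C : category) (x y : C) (f g : hom x y) :
  Arrow f = Arrow g -> f = g.
Proof.
pose cast (a : arrow C) (e1 : adom a = x) (e2 : acod a = y) : hom x y :=
  ecast z (hom z y) e1 (ecast z (hom (adom a) z) e2 (amor a)).
suff H (a : arrow C) (e : Arrow g = a) (e1 : adom a = x) (e2 : acod a = y) :
  g = cast a e1 e2.
  by move=> e; rewrite (H _ (esym e) erefl erefl).
by case: _ / e e1 e2 => /= e1 e2; rewrite (Prop_irrelevance e1 erefl)
  (Prop_irrelevance e2 erefl).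
Qed.

Lemma functor_ext (C D : category) (F G : functor C D) :
  (forall x y (f : hom x y), Arrow (fmor F f) = Arrow (fmor G f)) -> F = G.
Proof.
case: F G => [F Fm F1 FM] [G Gm G1 GM] /= H.
have E : F = G by apply: funext => x; exact (congr1 (@adom D) (H x x (idm x))).
subst G.
have E : Fm = Gm.
  apply: functional_extensionality_dep => x.
  apply: functional_extensionality_dep => y.
  by apply: funext => f; apply: Arrow_inj; apply: H.
subst Gm; congr Functor; exact: Prop_irrelevance.
Qed.

Lemma nat_trans_ext (C D : category) (F G : functor C D)
    (a b : nat_trans F G) : (forall x, a x = b x) -> a = b.
Proof.
case: a b => [a an] [b bn] /= H.
have E : a = b by apply: functional_extensionality_dep.
subst b; congr NatTrans; exact: Prop_irrelevance.
Qed.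

Definition functor_id (C : category) : functor C C :=
  @Functor C C id (fun _ _ f => f) (fun=> erefl) (fun _ _ _ _ _ => erefl).

Program Definition functor_comp (C D E : category) (K : functor D E)
    (F : functor C D) : functor C E :=
  @Functor C E (fun x => K (F x)) (fun _ _ f => fmor K (fmor F f)) _ _.
Next Obligation. by move=> *; rewrite /= !fmor1. Qed.
Next Obligation. by move=> *; rewrite /= !fmorM. Qed.

Definition functor_const (C D : category) (d : D) : functor C D :=
  @Functor C D (fun=> d) (fun _ _ _ => idm d) (fun=> erefl)
    (fun _ _ _ _ _ => esym (comp1m (idm d))).

Program Definition prod_cat (C D : category) : category :=
  @Category (C * D)%type
    (fun p q => (hom p.1 q.1 * hom p.2 q.2)%type)
    (fun p => (idm p.1, idm p.2))
    (fun _ _ _ g f => (g.1 \c f.1, g.2 \c f.2)) _ _ _.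
Next Obligation. by move=> *; rewrite /= !compmA. Qed.
Next Obligation. by move=> C D p q [f g]; rewrite !comp1m. Qed.
Next Obligation. by move=> C D p q [f g]; rewrite !compm1. Qed.

Program Definition functor_pair (B C D : category) (F : functor B C)
    (G : functor B D) : functor B (prod_cat C D) :=
  @Functor B (prod_cat C D) (fun x => (F x, G x))
    (fun _ _ f => (fmor F f, fmor G f)) _ _.
Next Obligation. by move=> *; rewrite /= !fmor1. Qed.
Next Obligation. by move=> *; rewrite /= !fmorM. Qed.

Program Definition functor_prod (C C' D D' : category) (F : functor C C')
    (G : functor D D') : functor (prod_cat C D) (prod_cat C' D') :=
  @Functor (prod_cat C D) (prod_cat C' D') (fun p => (F p.1, G p.2))
    (fun _ _ f => (fmor F f.1, fmor G f.2)) _ _.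
Next Obligation. by move=> *; rewrite /= !fmor1. Qed.
Next Obligation. by move=> *; rewrite /= !fmorM. Qed.

Definition prod_assoc (A B C : category) :
    functor (prod_cat (prod_cat A B) C) (prod_cat A (prod_cat B C)) :=
  @Functor (prod_cat (prod_cat A B) C) (prod_cat A (prod_cat B C))
    (fun p => (p.1.1, (p.1.2, p.2)))
    (fun _ _ f => (f.1.1, (f.1.2, f.2)))
    (fun=> erefl) (fun _ _ _ _ _ => erefl).

(* A strict 2-category is a category enriched in categories: [hom2 a b] is the
   category of 1-morphisms a -> b and 2-morphisms between them, its composition
   is the vertical one, and the functor [hcomp] composes 1-morphisms and,
   horizontally, 2-morphisms (so its functoriality is the interchange law). *)
Record two_category := TwoCategory {
  ob2 :> Type;
  hom2 : ob2 -> ob2 -> category;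
  id1 : forall a, hom2 a a;
  hcomp : forall a b c, functor (prod_cat (hom2 b c) (hom2 a b)) (hom2 a c);
  hcompA : forall a b c d,
    functor_comp (hcomp a b d)
      (functor_prod (hcomp b c d) (functor_id (hom2 a b))) =
    functor_comp (functor_comp (hcomp a c d)
      (functor_prod (functor_id (hom2 c d)) (hcomp a b c)))
      (prod_assoc (hom2 c d) (hom2 b c) (hom2 a b));
  hcomp1l : forall a b,
    functor_comp (hcomp a b b)
      (functor_pair (functor_const (hom2 a b) (id1 b))
                    (functor_id (hom2 a b))) = functor_id (hom2 a b);
  hcomp1r : forall a b,
    functor_comp (hcomp a a b)
      (functor_pair (functor_id (hom2 a b))
                    (functor_const (hom2 a b) (id1 a))) = functor_id (hom2 a b)
}.
Arguments hom2 {t} a b : rename.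
Arguments id1 {t} a : rename.
Arguments hcomp {t} a b c : rename.

(* The functors [fhom] preserve identity 2-morphisms and vertical composition;
   [fhom_id] and [fhom_comp] say that identity 1-morphisms, composition of
   1-morphisms and horizontal composition are preserved on the nose. *)
Record two_functor (K L : two_category) := TwoFunctor {
  fob2 :> K -> L;
  fhom : forall a b, functor (hom2 a b) (hom2 (fob2 a) (fob2 b));
  fhom_id : forall a, fhom a a (id1 a) = id1 (fob2 a);
  fhom_comp : forall a b c,
    functor_comp (fhom a c) (hcomp a b c) =
    functor_comp (hcomp (fob2 a) (fob2 b) (fob2 c))
      (functor_prod (fhom b c) (fhom a b))
}.

Definition full_sub2 (K : two_category) (X : Type) (i : X -> K) :
    two_category :=
  @TwoCategory X (fun a b => hom2 (i a) (i b)) (fun a => id1 (i a))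
    (fun a b c => hcomp (i a) (i b) (i c))
    (fun a b c d => hcompA (i a) (i b) (i c) (i d))
    (fun a b => hcomp1l (i a) (i b)) (fun a b => hcomp1r (i a) (i b)).

Program Definition nat_id (C D : category) (F : functor C D) :
    nat_trans F F := @NatTrans C D F F (fun x => idm (F x)) _.
Next Obligation. by move=> *; rewrite /= comp1m compm1. Qed.

Program Definition nat_vcomp (C D : category) (F G K : functor C D)
    (b : nat_trans G K) (a : nat_trans F G) : nat_trans F K :=
  @NatTrans C D F K (fun x => b x \c a x) _.
Next Obligation. by move=> *; rewrite /= -compmA nnat compmA nnat compmA. Qed.

Program Definition functor_cat (C D : category) : category :=
  @Category (functor C D) (@nat_trans C D) (@nat_id C D) (@nat_vcomp C D)
    _ _ _.
Next Obligation. by move=> *; apply: nat_trans_ext => x; apply: compmA. Qed.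
Next Obligation. by move=> *; apply: nat_trans_ext => x; apply: comp1m. Qed.
Next Obligation. by move=> *; apply: nat_trans_ext => x; apply: compm1. Qed.

Program Definition nat_hcomp (C D E : category) (K K' : functor D E)
    (F F' : functor C D) (b : nat_trans K K') (a : nat_trans F F') :
    nat_trans (functor_comp K F) (functor_comp K' F') :=
  @NatTrans C E (functor_comp K F) (functor_comp K' F')
    (fun x => fmor K' (a x) \c b (F x)) _.
Next Obligation.
move=> C D E K K' F F' b a x y f /=.
by rewrite -compmA nnat compmA -fmorM nnat fmorM compmA.
Qed.

Program Definition functor_hcomp (C D E : category) :
    functor (prod_cat (functor_cat D E) (functor_cat C D)) (functor_cat C E) :=
  @Functor (prod_cat (functor_cat D E) (functor_cat C D)) (functor_cat C E)
    (fun p => functor_comp p.1 p.2) (fun _ _ f => nat_hcomp f.1 f.2) _ _.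
Next Obligation.
by move=> C D E p; apply: nat_trans_ext => x /=; rewrite fmor1 comp1m.
Qed.
Next Obligation.
move=> C D E p q r g f; apply: nat_trans_ext => x /=.
by rewrite fmorM -!compmA; congr (_ \c _); rewrite !compmA nnat.
Qed.

Lemma nat_arrow_ext (C D : category) (F F' G G' : functor C D)
    (a : nat_trans F G) (b : nat_trans F' G') :
  F = F' -> G = G' -> (forall x, Arrow (a x) = Arrow (b x)) ->
  @Arrow (functor_cat C D) F G a = @Arrow (functor_cat C D) F' G' b.
Proof.
move=> eF eG; subst F' G' => H; congr Arrow.
by apply: nat_trans_ext => x; apply: Arrow_inj.
Qed.

Program Definition Cat : two_category :=
  @TwoCategory category functor_cat functor_id functor_hcomp _ _ _.
Next Obligation.
move=> A B C D; apply: functor_ext => p q f /=.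
apply: nat_arrow_ext => [||x /=]; try exact: functor_ext.
by rewrite fmorM compmA.
Qed.
Next Obligation.
move=> A B; apply: functor_ext => p q f /=.
apply: nat_arrow_ext => [||x /=]; try exact: functor_ext.
by rewrite compm1.
Qed.
Next Obligation.
move=> A B; apply: functor_ext => p q f /=.
apply: nat_arrow_ext => [||x /=]; try exact: functor_ext.
by rewrite fmor1 comp1m.
Qed.

Definition End (C : category) : two_category :=
  full_sub2 (K := Cat) (fun _ : unit => C).

Local Open Scope group_scope.

Record crossed_module := CrossedModule {
  cmG : groupType;
  cmH : groupType;
  cmact : cmG -> cmH -> cmH;
  cmbd : {multiplicative cmH -> cmG};
  cmact1 : forall e, cmact 1 e = e;
  cmactM : forall g h e, cmact (g * h) e = cmact g (cmact h e);
  cmact_morph : forall g, {morph cmact g : e z / e * z};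
  cmbd_act : forall g e, cmbd (cmact g e) = g * cmbd e * g^-1;
  cm_peiffer : forall e z, cmact (cmbd e) z = e * z * e^-1
}.
Arguments cmact {c} g e : rename.
Arguments cmbd {c} : rename.

Section TwoGroup.
Variable X : crossed_module.
Local Notation G := (cmG X).
Local Notation H := (cmH X).

(* The 2-morphism (g, e) : g => cmbd e * g is the element [e] of [cell g h]
   with h = cmbd e * g. *)
Definition cell (g h : G) : Type := {e : H | cmbd e * g == h}.

Lemma cmbd1 : cmbd (1 : H) = 1 :> G.
Proof. by apply: (mulIg (cmbd (1 : H))); rewrite -gmulfM mulg1 mul1g. Qed.

Lemma cmact_1 (g : G) : cmact g (1 : H) = 1.
Proof.
by apply: (mulIg (cmact g (1 : H))); rewrite -cmact_morph mulg1 mul1g.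
Qed.

Lemma cell_vcompP (g h k : G) (f : cell h k) (e : cell g h) :
  cmbd (sval f * sval e) * g == k.
Proof. by rewrite gmulfM -mulgA (eqP (svalP e)) (eqP (svalP f)). Qed.

Lemma cell_idP (g : G) : cmbd (1 : H) * g == g.
Proof. by rewrite cmbd1 mul1g. Qed.

Lemma cell_hcompP (g1 h1 g2 h2 : G) (e1 : cell g1 h1) (e2 : cell g2 h2) :
  cmbd (sval e1 * cmact g1 (sval e2)) * (g1 * g2) == h1 * h2.
Proof.
case: e1 e2 => [a /= /eqP <-] [b /= /eqP <-].
by rewrite gmulfM cmbd_act !mulgA mulgVK.
Qed.

Definition cell_id (g : G) : cell g g := exist _ 1 (cell_idP g).

Definition cell_vcomp (g h k : G) (f : cell h k) (e : cell g h) : cell g k :=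
  exist _ (sval f * sval e) (cell_vcompP f e).

Definition cell_hcomp (g1 h1 g2 h2 : G) (e1 : cell g1 h1) (e2 : cell g2 h2) :
    cell (g1 * g2) (h1 * h2) :=
  exist _ (sval e1 * cmact g1 (sval e2)) (cell_hcompP e1 e2).

Program Definition cat_group : category :=
  @Category G cell cell_id cell_vcomp _ _ _.
Next Obligation. by move=> *; apply: val_inj; apply: mulgA. Qed.
Next Obligation. by move=> *; apply: val_inj; apply: mul1g. Qed.
Next Obligation. by move=> *; apply: val_inj; apply: mulg1. Qed.

Program Definition cg_tensor :
    functor (prod_cat cat_group cat_group) cat_group :=
  @Functor (prod_cat cat_group cat_group) cat_group
    (fun p => (p.1 : G) * (p.2 : G)) (fun _ _ f => cell_hcomp f.1 f.2) _ _.
Next Obligation.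
by move=> p; apply: val_inj; rewrite /= cmact_1 mul1g.
Qed.
Next Obligation.
move=> [p p'] [q q'] [r r'] [[g gP] [g' gP']] [[f fP] [f' fP']].
apply: val_inj => /=; move: fP => /= /eqP <-.
by rewrite cmactM cm_peiffer cmact_morph !mulgA mulgVK.
Qed.

Lemma cell_arrow_ext (g h g' h' : G) (e : cell g h) (e' : cell g' h') :
  g = g' -> h = h' -> sval e = sval e' ->
  @Arrow cat_group g h e = @Arrow cat_group g' h' e'.
Proof. by move=> eg eh; subst g' h' => ee; congr Arrow; apply: val_inj. Qed.

Program Definition two_group : two_category :=
  @TwoCategory unit (fun _ _ => cat_group) (fun=> (1 : G))
    (fun _ _ _ => cg_tensor) _ _ _.
Next Obligation.
move=> ? ? ? ?; apply: functor_ext => p q f /=.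
apply: cell_arrow_ext => /=; rewrite ?mulgA //.
by rewrite cmactM cmact_morph mulgA.
Qed.
Next Obligation.
move=> ? ?; apply: functor_ext => p q f /=.
by apply: cell_arrow_ext => /=; rewrite ?mul1g ?cmact1.
Qed.
Next Obligation.
move=> ? ?; apply: functor_ext => p q f /=.
by apply: cell_arrow_ext => /=; rewrite ?mulg1 // cmact_1 mulg1.
Qed.

(* The unit condition is Phi(1, -) = Id_C.  Its object part alone is not
   enough: when G and H are trivial, every idempotent endofunctor of C that
   fixes all objects satisfies the two other fields, and only the identity
   functor is given by a strict 2-functor to End(C). *)
Record strict_action (C : category) := StrictAction {
  saction :> functor (prod_cat cat_group C) C;
  saction_tensor :
    functor_comp saction (functor_prod cg_tensor (functor_id C)) =
    functor_comp (functor_comp saction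
      (functor_prod (functor_id cat_group) saction))
      (prod_assoc cat_group cat_group C);
  saction_unit : forall x : C, saction ((1 : G), x) = x;
  saction_unit_mor : forall (x y : C) (f : hom x y),
    Arrow (@fmor _ _ saction ((1 : G), x) ((1 : G), y) (cell_id 1, f)) = Arrow f
}.

Section Components.
Variables (C : category) (Phi : two_functor two_group (End C)).

Definition endo (g : G) : functor C C := fhom Phi tt tt g.

Definition endo_nat (g h : G) (e : cell g h) : nat_trans (endo g) (endo h) :=
  @fmor _ _ (fhom Phi tt tt) g h e.

End Components.
End TwoGroup.

(* Main.v *)
(* The correspondence is currying.  A 2-functor gives
   [(e, f) |-> Phi_h(f) \c Phi_e(x)], and an action A gives back
   [Phi_g(f) = A(1_g, f)] and [Phi_e(x) = A(e, 1_x)]; functoriality in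
   G x C is functoriality in each variable plus naturality.  Horizontal
   composition in End(C) is exactly the compatibility of A with the tensor
   product. *)
Require Import Defs.
From mathcomp Require Import all_boot.
From mathcomp Require Import boolp.

Set Implicit Arguments.
Unset Strict Implicit.
Unset Printing Implicit Defensive.

Local Open Scope cat_scope.
Local Open Scope group_scope.

#[local] Obligation Tactic := idtac.

(** Converse of [functor_ext]: it evaluates an equality of functors, such as [fhom_comp] or
    [saction_tensor], at one morphism. [Arrow] absorbs the change of (co)domain. *)
Lemma functor_arrow (C D : category) (F G : functor C D) (x y : C)
    (f : hom x y) : F = G -> Arrow (fmor F f) = Arrow (fmor G f).
Proof. by move=> ->. Qed.

(* Taking the 2-morphism as a packed arrow lets [congr1] transport along
   equalities between 2-morphisms whose (co)domains are only provably equal. *)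
Definition nat_eval (C D : category) (t : arrow (functor_cat C D)) (x y : C)
    (f : hom x y) : arrow D :=
  Arrow (fmor (acod t : functor C D) f \c (amor t : nat_trans _ _) x).

Section Correspondence.
Variables (X : crossed_module) (C : category).
Local Notation G := (cmG X).

(** Source and target each have a single object, so all the data of a 2-functor lies in [fhom] at
    [tt], [tt]; the remaining fields are propositions. *)
Lemma two_functor_ext (Phi Psi : two_functor (two_group X) (End C)) :
  (forall (g : G) (x y : C) (f : hom x y),
     Arrow (fmor (endo Phi g) f) = Arrow (fmor (endo Psi g) f)) ->
  (forall (g h : G) (e : cell g h) (x : C),
     Arrow (endo_nat Phi e x) = Arrow (endo_nat Psi e x)) ->
  Phi = Psi.
Proof.
move=> Hob Hmor.
(* The hom-categories of [End C] do not depend on the chosen objects, so this equation is well typed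
   before the object maps are identified. *)
have E : fhom Phi tt tt = fhom Psi tt tt.
  apply: functor_ext => g h e.
  apply: nat_arrow_ext => [||x]; last exact: Hmor.
    by apply: functor_ext; apply: Hob.
  by apply: functor_ext; apply: Hob.
case: Phi Psi E {Hob Hmor} => [p P P1 PM] [q Q Q1 QM] /= E.
have Epq : p = q by apply: funext => a; case: (p a) (q a) => -[].
subst q; have EPQ : P = Q.
  apply: functional_extensionality_dep => -[].
  by apply: functional_extensionality_dep => -[].
by subst Q; congr TwoFunctor; apply: Prop_irrelevance.
Qed.

Lemma strict_action_ext (A B : strict_action X C) :
  saction A = saction B -> A = B.
Proof.
case: A B => [A A1 A2 A3] [B B1 B2 B3] /= E; subst B.
by congr StrictAction; apply: Prop_irrelevance.
Qed.

Section ActionOfTwoFunctor.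
Variable Phi : two_functor (two_group X) (End C).

Lemma endo_nat_id (g : G) (x : C) :
  endo_nat Phi (cell_id g) x = idm (endo Phi g x).
Proof.
by rewrite /endo_nat; have /= -> := @fmor1 _ _ (fhom Phi tt tt) g.
Qed.

Lemma endo_nat_vcomp (g h k : G) (e' : cell h k) (e : cell g h) (x : C) :
  endo_nat Phi (cell_vcomp e' e) x = endo_nat Phi e' x \c endo_nat Phi e x.
Proof.
by rewrite /endo_nat; have /= -> := @fmorM _ _ (fhom Phi tt tt) g h k e' e.
Qed.

Lemma endo1 : endo Phi (1 : G) = functor_id C.
Proof. exact: (fhom_id Phi tt). Qed.

(** This is [fhom_comp] at the morphism [(e, e')]. Packed arrows are used because
    [endo Phi (g * g')] is only provably the composite functor. *)
Lemma endo_nat_hcomp (g h g' h' : G) (e : cell g h) (e' : cell g' h') :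
  @Arrow (functor_cat C C) _ _ (endo_nat Phi (cell_hcomp e e')) =
  @Arrow (functor_cat C C) _ _ (nat_hcomp (endo_nat Phi e) (endo_nat Phi e')).
Proof.
exact: (@functor_arrow _ _ _ _ ((g, g') : prod_cat (cat_group X) (cat_group X))
  (h, h') (e, e') (fhom_comp Phi tt tt tt)).
Qed.

Program Definition action_functor : functor (prod_cat (cat_group X) C) C :=
  @Functor (prod_cat (cat_group X) C) C (fun p => endo Phi p.1 p.2)
    (fun p q u => fmor (endo Phi q.1) u.2 \c endo_nat Phi u.1 p.2) _ _.
Next Obligation. by move=> [g x] /=; rewrite fmor1 comp1m endo_nat_id. Qed.
Next Obligation.
move=> [g x] [h y] [k z] [e' f'] [e f] /=.
rewrite endo_nat_vcomp fmorM -!compmA; congr (_ \c _).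
(* Naturality of [endo_nat Phi e'] at [f] exchanges the two middle factors. *)
by rewrite !compmA nnat.
Qed.

Lemma action_functor_tensor :
  functor_comp action_functor (functor_prod (cg_tensor X) (functor_id C)) =
  functor_comp (functor_comp action_functor
    (functor_prod (functor_id (cat_group X)) action_functor))
    (prod_assoc (cat_group X) (cat_group X) C).
Proof.
apply: functor_ext => -[[g g'] x] [[h h'] y] [[e e'] f] /=.
(* Evaluating the horizontal composition law at [f] gives the value of the action on
   [(cell_hcomp e e', f)]; the nested action then agrees with it because [endo Phi h] preserves
   composition. *)
have /= := congr1 (fun t => nat_eval t f) (endo_nat_hcomp e e').
by rewrite /nat_eval /= => ->; rewrite fmorM compmA.
Qed.

Lemma action_functor_unit (x : C) : action_functor ((1 : G), x) = x.
Proof. by rewrite /= endo1. Qed.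

Lemma action_functor_unit_mor (x y : C) (f : hom x y) :
  Arrow (@fmor _ _ action_functor ((1 : G), x) ((1 : G), y) (cell_id 1, f)) =
  Arrow f.
Proof. by rewrite /= endo_nat_id compm1 (functor_arrow f endo1). Qed.

Definition action_of_two_functor : strict_action X C :=
  StrictAction action_functor_tensor action_functor_unit
    action_functor_unit_mor.

End ActionOfTwoFunctor.

Section TwoFunctorOfAction.
Variable A : strict_action X C.

Definition act_mor (g h : G) (x y : C) (e : cell g h) (f : hom x y) :
    hom (A (g, x)) (A (h, y)) :=
  @fmor _ _ A (g, x) (h, y) (e, f).

Lemma act_mor_id (g : G) (x : C) :
  act_mor (cell_id g) (idm x) = idm (A (g, x)).
Proof. exact: (@fmor1 _ _ A (g, x)). Qed.

Lemma act_morM (g h k : G) (x y z : C) (e' : cell h k) (e : cell g h)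
    (f' : hom y z) (f : hom x y) :
  act_mor (cell_vcomp e' e) (f' \c f) = act_mor e' f' \c act_mor e f.
Proof. exact: (@fmorM _ _ A (g, x) (h, y) (k, z) (e', f') (e, f)). Qed.

Lemma cell_vcomp1l (g h : G) (e : cell g h) : cell_vcomp (cell_id h) e = e.
Proof. exact: (@comp1m (cat_group X)). Qed.

Lemma cell_vcomp1r (g h : G) (e : cell g h) : cell_vcomp e (cell_id g) = e.
Proof. exact: (@compm1 (cat_group X)). Qed.

(** In the product category [(e, f)] factors as [(1, f)] after [(e, 1)]. With the opposite
    factorisation in [act_mor_splitr], this yields the naturality of [act_nat]. *)
Lemma act_mor_splitl (g h : G) (x y : C) (e : cell g h) (f : hom x y) :
  act_mor (cell_id h) f \c act_mor e (idm x) = act_mor e f.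
Proof. by rewrite -act_morM cell_vcomp1l compm1. Qed.

Lemma act_mor_splitr (g h : G) (x y : C) (e : cell g h) (f : hom x y) :
  act_mor e (idm y) \c act_mor (cell_id g) f = act_mor e f.
Proof. by rewrite -act_morM cell_vcomp1r comp1m. Qed.

Lemma act_mor_tensor (g h g' h' : G) (x y : C) (e : cell g h)
    (e' : cell g' h') (f : hom x y) :
  Arrow (act_mor (cell_hcomp e e') f) = Arrow (act_mor e (act_mor e' f)).
Proof.
exact: (@functor_arrow _ _ _ _
  ((g, g', x) : prod_cat (prod_cat (cat_group X) (cat_group X)) C)
  (h, h', y) (e, e', f) (saction_tensor A)).
Qed.

Lemma cell_hcomp_id (g g' : G) :
  cell_hcomp (cell_id g) (cell_id g') = cell_id (g * g').
Proof. exact: (@fmor1 _ _ (cg_tensor X) (g, g')). Qed.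

Program Definition act_endo (g : G) : functor C C :=
  @Functor C C (fun x => A (g, x)) (fun _ _ f => act_mor (cell_id g) f) _ _.
Next Obligation. by move=> g x; apply: act_mor_id. Qed.
Next Obligation.
by move=> g x y z f' f /=; rewrite -act_morM cell_vcomp1l.
Qed.

Program Definition act_nat (g h : G) (e : cell g h) :
    nat_trans (act_endo g) (act_endo h) :=
  @NatTrans C C (act_endo g) (act_endo h) (fun x => act_mor e (idm x)) _.
Next Obligation.
by move=> g h e x y f /=; rewrite act_mor_splitl act_mor_splitr.
Qed.

Program Definition act_hom : functor (cat_group X) (functor_cat C C) :=
  @Functor (cat_group X) (functor_cat C C) act_endo act_nat _ _.
Next Obligation. by move=> g; apply: nat_trans_ext => x; apply: act_mor_id. Qed.
Next Obligation.
by move=> g h k e' e; apply: nat_trans_ext => x /=; rewrite -act_morM comp1m.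
Qed.

(** Preservation of the identity 1-morphism comes from the unit condition on morphisms. *)
Lemma act_endo1 : act_endo 1 = functor_id C.
Proof. by apply: functor_ext => x y f; apply: saction_unit_mor. Qed.

(** The tensor law is applied to identity cells, whose horizontal composite is again an identity
    cell. *)
Lemma act_endoM (g g' : G) :
  act_endo (g * g') = functor_comp (act_endo g) (act_endo g').
Proof.
by apply: functor_ext => x y f /=; rewrite -cell_hcomp_id act_mor_tensor.
Qed.

Lemma act_hom_comp :
  functor_comp act_hom (cg_tensor X) =
  functor_comp (functor_hcomp C C C) (functor_prod act_hom act_hom).
Proof.
apply: functor_ext => -[g g'] [h h'] [e e'] /=.
apply: nat_arrow_ext => [||x /=]; try exact: act_endoM.
(* The tensor law turns the left side into [A] at [e] and [act_mor e' (idm x)]; the horizontal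
   composite on the right is the factorisation of that same morphism. *)
by rewrite act_mor_tensor act_mor_splitl.
Qed.

Definition two_functor_of_action : two_functor (two_group X) (End C) :=
  @TwoFunctor (two_group X) (End C) id (fun _ _ => act_hom)
    (fun=> act_endo1) (fun _ _ _ => act_hom_comp).

End TwoFunctorOfAction.

Lemma action_of_two_functorK :
  cancel action_of_two_functor two_functor_of_action.
Proof.
move=> Phi; apply: two_functor_ext => [g x y f|g h e x].
  by rewrite /= /act_mor /= endo_nat_id compm1.
by rewrite /endo_nat /= /act_mor /= fmor1 comp1m.
Qed.

Lemma two_functor_of_actionK :
  cancel two_functor_of_action action_of_two_functor.
Proof.
move=> A; apply: strict_action_ext.
apply: functor_ext => -[g x] [h y] [e f] /=.
(* Currying and uncurrying replaces [A] on [(e, f)] by its factorisation into the two variables. *)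
by rewrite /endo_nat /= act_mor_splitl.
Qed.

End Correspondence.

Theorem theorem3p4 (X : crossed_module) (C : category) :
  exists hat : two_functor (two_group X) (End C) -> strict_action X C,
    bijective hat /\
    forall Phi : two_functor (two_group X) (End C),
      (forall (g : cmG X) (x : C), hat Phi (g, x) = endo Phi g x) /\
      (forall (g h : cmG X) (e : cell g h) (x y : C) (f : hom x y),
         Arrow (@fmor _ _ (hat Phi) (g, x) (h, y) (e, f)) =
         Arrow (fmor (endo Phi h) f \c endo_nat Phi e x)).
Proof.
exists (@action_of_two_functor X C); split=> [|Phi]; last by split.
by exists (@two_functor_of_action X C);
  [apply: action_of_two_functorK|apply: two_functor_of_actionK].
Qed.
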